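(* Let $\mathcal{D}=(S,\mathbf{P},L)$ be a DTMC. Define $R_1=\{(s_1,s_2)\in S\times S:L(s_1)=L(s_2)\}$ and, for $i\ge1$, $R_{i+1}=\{(s_1,s_2)\in R_i:\ s_1\sqsubseteq^w_{R_i}s_2\}$. If $k$ is an index with $R_{k+1}=R_k$, then $R_k$ equals the weak simulation preorder $\preceq^w_{\mathcal{D}}$.
   Context: A DTMC is $\mathcal{D}=(S,\mathbf{P},L)$ with $S$ finite, $L:S\to2^{AP}$, $\mathbf{P}:S\times S\to[0,1]$ with $\sum_t\mathbf{P}(s,t)\in\{0,1\}$ for every $s$; $\mathrm{post}(s)=\{t:\mathbf{P}(s,t)>0\}$. For $R\subseteq S\times S$ and $s_1,s_2\in S$, $s_1\sqsubseteq^w_Rs_2$ iff there are $\delta_1,\delta_2:S\to[0,1]$ such that, with $U_i=\{u\in\mathrm{post}(s_i):\delta_i(u)>0\}$, $V_i=\{v\in\mathrm{post}(s_i):\delta_i(v)<1\}$, $K_i=\sum_{u\in U_i}\delta_i(u)\mathbf{P}(s_i,u)$: (1) $(v,s_2)\in R$ for all $v\in V_1$ and $(s_1,v)\in R$ for all $v\in V_2$; (2) there is $\Delta:S\times S\to[0,1]$ with (a) $\Delta(u_1,u_2)>0\Rightarrow u_1\in U_1,u_2\in U_2,(u_1,u_2)\in R$, (b) if $K_1,K_2>0$ then for all $w$: $K_1\sum_{u\in U_2}\Delta(w,u)=\mathbf{P}(s_1,w)\delta_1(w)$ and $K_2\sum_{u\in U_1}\Delta(u,w)=\mathbf{P}(s_2,w)\delta_2(w)$;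 (3) for every $u_1\in U_1$ there is a path $s_2,w_1,\dots,w_n,u_2$ ($n\ge0$) with positive one-step probabilities, $(s_1,w_j)\in R$ for $1\le j\le n$, and $(u_1,u_2)\in R$. A weak simulation is $R\subseteq S\times S$ such that every $(s_1,s_2)\in R$ has $L(s_1)=L(s_2)$ and $s_1\sqsubseteq^w_Rs_2$; $s_1\preceq^w_{\mathcal{D}}s_2$ iff some weak simulation contains $(s_1,s_2)$. *)

(* Defs.v *)
From HB Require Import structures.
From mathcomp Require Import all_boot all_order all_algebra.
From mathcomp Require Import boolp classical_sets reals.

Set Implicit Arguments.
Unset Strict Implicit.
Unset Printing Implicit Defensive.

Import Order.TTheory GRing.Theory Num.Theory.
Local Open Scope classical_set_scope.
Local Open Scope ring_scope.

Record dtmc (R : realType) (S : finType) (AP : Type) := Dtmc {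
  prob : S -> S -> R;
  label : S -> set AP;
  prob_itv01 : forall s t, 0 <= prob s t <= 1;
  prob_sum : forall s, \sum_t prob s t = 0 \/ \sum_t prob s t = 1
}.

Section WeakSimulation.
Context {R : realType} {S : finType} {AP : Type} (D : dtmc R S AP).

Local Notation P := (prob D).
Local Notation L := (label D).

Definition post (s : S) : {set S} := finset (fun t => 0 < P s t).

Definition visible (s : S) (delta : S -> R) : {set S} :=
  finset (fun u => (u \in post s) && (0 < delta u)).

Definition stutter (s : S) (delta : S -> R) : {set S} :=
  finset (fun v => (v \in post s) && (delta v < 1)).

Definition weight (s : S) (delta : S -> R) : R :=
  \sum_(u in visible s delta) delta u * P s u.

Definition weight_matching (Q : set (S * S)) (s1 s2 : S)
    (delta1 delta2 : S -> R) (Delta : S -> S -> R) : Prop :=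
  let U1 := visible s1 delta1 in
  let U2 := visible s2 delta2 in
  let K1 := weight s1 delta1 in
  let K2 := weight s2 delta2 in
  (forall u1 u2, 0 < Delta u1 u2 ->
     [/\ u1 \in U1, u2 \in U2 & Q (u1, u2)]) /\
  (0 < K1 -> 0 < K2 -> forall w,
     K1 * (\sum_(u in U2) Delta w u) = P s1 w * delta1 w /\
     K2 * (\sum_(u in U1) Delta u w) = P s2 w * delta2 w).

Definition weak_step (Q : set (S * S)) (s1 s2 : S) : Prop :=
  exists delta1 delta2 : S -> R,
  [/\ (forall u, 0 <= delta1 u <= 1) /\ (forall u, 0 <= delta2 u <= 1),
      (forall v, v \in stutter s1 delta1 -> Q (v, s2)) /\
      (forall v, v \in stutter s2 delta2 -> Q (s1, v)),
      (exists Delta : S -> S -> R,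
         (forall u1 u2, 0 <= Delta u1 u2 <= 1) /\
         weight_matching Q s1 s2 delta1 delta2 Delta) &
      forall u1, u1 \in visible s1 delta1 ->
        exists (ws : seq S) (u2 : S),
        [/\ path (fun s t => 0 < P s t) s2 (rcons ws u2),
            forall w, w \in ws -> Q (s1, w) &
            Q (u1, u2)]].

Definition weak_simulation (Q : set (S * S)) : Prop :=
  forall s1 s2, Q (s1, s2) -> L s1 = L s2 /\ weak_step Q s1 s2.

Definition weak_sim_preorder : set (S * S) :=
  [set p | exists Q, weak_simulation Q /\ Q p].

Definition same_label : set (S * S) := [set p | L p.1 = L p.2].

Definition refine_step (Q : set (S * S)) : set (S * S) :=
  [set p | Q p /\ weak_step Q p.1 p.2].

(* The sequence is indexed from 1: [approx 1] is [same_label] and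
   [approx i.+1 = refine_step (approx i)] for [1 <= i].  The value at 0 is a
   dummy equal to that at 1, so statements about [approx i] need [1 <= i]. *)
Definition approx (i : nat) : set (S * S) := iter i.-1 refine_step same_label.

End WeakSimulation.

(* Main.v *)
Require Import Defs.
From HB Require Import structures.
From mathcomp Require Import all_boot all_order all_algebra.
From mathcomp Require Import boolp classical_sets reals.

Set Implicit Arguments.
Unset Strict Implicit.
Unset Printing Implicit Defensive.

(** The relation [Q] occurs only positively in the weak step condition, so
    every weak simulation is contained in all approximants, and a fixed point
    of the refinement is itself a weak simulation. *)

Local Open Scope classical_set_scope.

Section WeakSimulationFixpoint.
Context {R : realType} {S : finType} {AP : Type} (D : dtmc R S AP).

(** The witnesses [d1], [d2], [Delta] and the paths are kept; only the memberships in [Q] are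
    carried along the inclusion. *)
Lemma weak_step_mono (Q Q' : set (S * S)) s1 s2 :
  Q `<=` Q' -> weak_step D Q s1 s2 -> weak_step D Q' s1 s2.
Proof.
move=> QQ' [d1 [d2 [d01 [st1 st2] [Delta [Delta01 [supp bal]]] reach]]].
exists d1, d2; split=> //.
- by split=> v /[dup] ? => [/st1|/st2] /QQ'.
- exists Delta; split=> //; split=> // u1 u2 /supp[? ? ?].
  by split=> //; exact: QQ'.
- move=> u1 /reach[ws [u2 [pth wsQ u12]]].
  by exists ws, u2; split=> // [w /wsQ|]; exact: QQ'.
Qed.

Lemma approxS i : 0 < i -> approx D i.+1 = refine_step D (approx D i).
Proof. by case: i. Qed.

Lemma approx_sub_same_label i : approx D i `<=` same_label D.
Proof. by case: i => // i; elim: i => // i IH p [/IH]. Qed.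

Lemma weak_simulation_sub_approx (Q : set (S * S)) i :
  weak_simulation D Q -> Q `<=` approx D i.
Proof.
move=> simQ; rewrite /approx.
(* Inducting on the number of refinements [i.-1] covers index 0 too. Equal labels give the base
   case; monotonicity lifts each step from [Q] to the current approximant. *)
elim: i.-1 => [|j IH] [s1 s2] Qs; have [eqL step] := simQ _ _ Qs => //.
by split; [exact: IH | exact: weak_step_mono step].
Qed.

Lemma weak_simulation_approx i :
  0 < i -> approx D i.+1 = approx D i -> weak_simulation D (approx D i).
Proof.
move=> i_gt0 fixi s1 s2 Rs; split; first exact: (approx_sub_same_label Rs).
(* Only the membership assumption moves up to [i.+1], so unfolding it yields a weak step relative to
   [approx D i] itself. *)
by move: Rs; rewrite -{1}fixi approxS// => -[].
Qed.

End WeakSimulationFixpoint.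

Local Close Scope classical_set_scope.

Theorem theorem5p10 (R : realType) (S : finType) (AP : Type)
    (D : dtmc R S AP) (k : nat) (hk : 1 <= k)
    (hfix : approx D k.+1 = approx D k) :
  approx D k = weak_sim_preorder D.
Proof.
apply/seteqP; split=> [p Rp | p [Q [simQ Qp]]].
  by exists (approx D k); split=> //; exact: weak_simulation_approx.
exact: weak_simulation_sub_approx simQ _ Qp.
Qed.
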